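(* Fix $z \in (0,\tfrac14)$ and two domino cells $D_{\mathrm h}$ and $D_{\mathrm v}$, each with its set of non-leaves as distinguished set, $D_{\mathrm h}$ meeting the connecting cell in value and $D_{\mathrm v}$ meeting it in position. Then for every $c \ge 1$, all sums running over the connecting cells $C$ with exactly $c$ skew components, $$\sum_C z^{|C|} N_{\mathrm h}(C; D_{\mathrm h})\, N_{\mathrm v}(C; D_{\mathrm v}) \;\ge\; \frac{\bigl(\sum_C z^{|C|} N_{\mathrm h}(C; D_{\mathrm h})\bigr)\bigl(\sum_C z^{|C|} N_{\mathrm v}(C; D_{\mathrm v})\bigr)}{Q(z)^{c}} ,$$ where $Q(z) = \tfrac12\bigl(1-\sqrt{1-4z}\bigr)$.
   Context: A connecting cell $C$ is a permutation in a fixed one of the two classes $\operatorname{Av}(213)$, $\operatorname{Av}(132)$; $|C|$ is its number of points. Every permutation is uniquely a skew sum $c_1 \ominus \cdots \ominus c_r$ of skew indecomposable permutations, its skew components; they occupy consecutive position intervals and consecutive value intervals, earlier components holding larger values. The function $Q(z)$ is the generating function, by number of points, of the nonempty skew indecomposable permutations in $\operatorname{Av}(213)$ (equivalently, in $\operatorname{Av}(132)$). A domino cell $D$ is a finite permutation avoiding $213$ or avoiding $132$. Its leaves are its right-to-left maxima if it is a cell of the $\operatorname{Av}(213)$ kind, and its left-to-right minima if it is a cell of the $\operatorname{Av}(132)$ kind; its other points are non-leaves. Placements. Let $C$ have skew components of sizes $\mathbf w = (w_1,\dots,w_c)$, read along the axis (position or value) on which $D$ and $C$ interleave, and let $D$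 be a domino cell with a distinguished set $S$ of its points. A placement of $D$ against $C$ is a weakly increasing map from the points of $D$, totally ordered along that axis, to $\{0,1,\dots,|C|\}$ (the image of a point counts how many points of $C$ precede it along the axis). It is admissible if every point of $S$ is sent into $G(\mathbf w) = \{0,\sigma_1,\dots,\sigma_c\}$, where $\sigma_i = w_1+\cdots+w_i$. $N(C;D)$ is the number of admissible placements. $N_{\mathrm v}(C;D_{\mathrm v})$ is this count with position as the axis (points of $D_{\mathrm v}$ ordered by position, components of $C$ read left to right); $N_{\mathrm h}(C;D_{\mathrm h})$ is this count with value as the axis (points of $D_{\mathrm h}$ ordered by value, components of $C$ read in increasing value, i.e. in the reverse of the position order). In both, $S$ is the set of non-leaves. *)

(* Defs.v *)
From mathcomp Require Import all_boot all_order all_algebra all_fingroup.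
From mathcomp Require Import all_classical all_reals all_analysis.
Set Implicit Arguments.
Unset Strict Implicit.
Unset Printing Implicit Defensive.
Import Order.TTheory GRing.Theory Num.Theory.

(* Permutations are kept in zero-based one-line notation: the point in position
   i : 'I_n of s : 'S_n has value s i. *)
Definition permutation := {n : nat & 'S_n}.

Definition psize (A : permutation) : nat := tag A.

Definition mkperm (n : nat) (s : 'S_n) : permutation :=
  Tagged (fun n => {perm 'I_n}) s.

Definition perm0 : permutation := mkperm (1%g : 'S_0).

(* The skew sum of s and t puts s to the left of and above t. *)
Section SkewSum.
Variables (m n : nat) (s : 'S_m) (t : 'S_n).

Definition skew_fun (i : 'I_(m + n)) : 'I_(m + n) :=
  cast_ord (addnC n m)
    (match fintype.split i with inl a => rshift n (s a) | inr b => lshift m (t b) end).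

Lemma skew_fun_inj : injective skew_fun.
Proof.
move=> i j /cast_ord_inj H; apply: (can_inj (@splitK m n)); move: H.
case: (fintype.split i) => a; case: (fintype.split j) => b /= /eqP.
- by rewrite eq_rshift => /eqP /perm_inj ->.
- by rewrite eq_rlshift.
- by rewrite eq_lrshift.
- by rewrite eq_lshift => /eqP /perm_inj ->.
Qed.

Definition skew_perm : 'S_(m + n) := perm skew_fun_inj.

End SkewSum.

Definition skew (A B : permutation) : permutation :=
  mkperm (skew_perm (tagged A) (tagged B)).

Definition skew_indecomposable (A : permutation) : Prop :=
  (0 < psize A)%N /\
  forall B B' : permutation, A = skew B B' -> psize B = 0%N \/ psize B' = 0%N.

Definition is_skew_decomposition (A : permutation) (cs : seq permutation) : Prop :=
  A = foldr skew perm0 cs /\ (forall B, B \in cs -> skew_indecomposable B).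

(* Well defined: see skew_componentsP and skew_decomposition_uniq below. *)
Definition skew_components (A : permutation) : seq permutation :=
  xget [::] [set cs | is_skew_decomposition A cs]%classic.

Definition contains (m n : nat) (p : 'S_m) (s : 'S_n) : bool :=
  [exists f : {ffun 'I_m -> 'I_n},
    [forall i : 'I_m, forall j : 'I_m,
      ((i < j)%N ==> (f i < f j)%N) &&
      ((p i < p j)%N == (s (f i) < s (f j))%N)]].

Variant cell_kind := Av213 | Av132.

(* In zero-based one-line notation the patterns are 1 0 2 and 0 2 1. *)
Definition basis (k : cell_kind) : 'S_3 :=
  match k with
  | Av213 => tperm (inord 0) (inord 1)
  | Av132 => tperm (inord 1) (inord 2)
  end.

Definition in_class (k : cell_kind) (A : permutation) : Prop :=
  ~~ contains (basis k) (tagged A).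

Definition rl_max (n : nat) (s : 'S_n) (i : 'I_n) : bool :=
  [forall j : 'I_n, (i < j)%N ==> (s j < s i)%N].

Definition lr_min (n : nat) (s : 'S_n) (i : 'I_n) : bool :=
  [forall j : 'I_n, (j < i)%N ==> (s i < s j)%N].

(* Points of a permutation are identified with their positions. *)
Definition leaves (k : cell_kind) (D : permutation) : {set 'I_(psize D)} :=
  match k with
  | Av213 => [set i | rl_max (tagged D) i]
  | Av132 => [set i | lr_min (tagged D) i]
  end.

Definition nonleaves (k : cell_kind) (D : permutation) : {set 'I_(psize D)} :=
  ~: leaves k D.

Definition gates (w : seq nat) : seq nat :=
  [seq sumn (take i w) | i <- iota 0 (size w).+1].

(* Here n is the number of points of the connecting cell, w lists the sizes of
   its components along the axis, and key gives the coordinate along the axis of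
   each of the m points of the domino cell. *)
Definition admissible (n : nat) (w : seq nat) (m : nat) (key : 'I_m -> nat)
    (S : {set 'I_m}) (f : {ffun 'I_m -> 'I_n.+1}) : bool :=
  [forall i : 'I_m, forall j : 'I_m, (key i <= key j)%N ==> (f i <= f j)%N] &&
  [forall i in S, (f i : nat) \in gates w].

Definition num_placements (n : nat) (w : seq nat) (m : nat) (key : 'I_m -> nat)
    (S : {set 'I_m}) : nat :=
  #|[set f : {ffun 'I_m -> 'I_n.+1} | admissible w key S f]|.

Definition component_sizes (C : permutation) : seq nat :=
  [seq psize B | B <- skew_components C].

Definition Nv (C : permutation) (k : cell_kind) (D : permutation) : nat :=
  num_placements (psize C) (component_sizes C)
    (fun i : 'I_(psize D) => i : nat) (nonleaves k D).

Definition Nh (C : permutation) (k : cell_kind) (D : permutation) : nat :=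
  num_placements (psize C) (rev (component_sizes C))
    (fun i : 'I_(psize D) => tagged D i : nat) (nonleaves k D).

Definition connecting_cells (k : cell_kind) (c : nat) : set permutation :=
  [set C | in_class k C /\ size (skew_components C) = c]%classic.

Definition Q (R : realType) (z : R) : R :=
  ((1 - Num.sqrt (1 - 4 * z)) / 2)%R.

Definition word (A : permutation) : seq nat :=
  [seq (tagged A i : nat) | i <- enum 'I_(psize A)].

Lemma size_word A : size (word A) = psize A.
Proof. by rewrite size_map size_enum_ord. Qed.

Lemma word_inj : injective word.
Proof.
case=> n s [m t] H; have /= E : n = m.
  by have := congr1 size H; rewrite !size_word.
subst m; congr existT; apply/permP => i; apply/val_inj.
by move/eq_in_map: H => /= /(_ i (mem_enum _ i)).
Qed.

Lemma nth_word A (i : 'I_(psize A)) : nth 0%N (word A) i = tagged A i.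
Proof. by rewrite (nth_map i) ?size_enum_ord // nth_ord_enum. Qed.

Lemma word_skew A B :
  word (skew A B) = map (addn (psize B)) (word A) ++ word B.
Proof.
apply: (@eq_from_nth _ 0%N).
  by rewrite size_cat size_map !size_word.
move=> i; rewrite size_word => lti; pose o := Ordinal lti.
rewrite (nth_word (A := skew A B) o) /= permE /skew_fun /=.
rewrite nth_cat size_map size_word /psize /=.
rewrite -[i]/(nat_of_ord o).
case: splitP => [a|b] -> /=.
  rewrite (nth_map 0%N) ?size_word ?ltn_ord //.
  by rewrite (nth_word (A := A) a).
by rewrite addKn (nth_word (A := B) b).
Qed.

Lemma word_perm0 : word perm0 = [::].
Proof. by apply: size0nil; rewrite size_word. Qed.

Lemma perm_word A : perm_eq (word A) (iota 0 (psize A)).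
Proof.
have uw : uniq (word A).
  by rewrite map_inj_uniq ?enum_uniq // => i j /val_inj /perm_inj.
have sub : {subset word A <= iota 0 (psize A)}.
  by move=> x /mapP[i _ ->]; rewrite mem_iota /=.
apply: uniq_perm => //; first exact: iota_uniq.
apply: (uniq_min_size uw sub _).2.
by rewrite size_iota size_word.
Qed.

Lemma word_surj u : perm_eq u (iota 0 (size u)) -> exists A, word A = u.
Proof.
move=> Hu; set n := size u.
have lt_n (i : 'I_n) : (nth 0 u i < n)%N.
  have : nth 0%N u i \in iota 0 n by rewrite -(perm_mem Hu) mem_nth.
  by rewrite mem_iota.
have uu : uniq u by rewrite (perm_uniq Hu) iota_uniq.
have inj : injective (fun i : 'I_n => Ordinal (lt_n i)).
  move=> i j /(congr1 val) /= /eqP.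
  by rewrite nth_uniq // => /eqP /val_inj.
exists (mkperm (perm inj)); apply: (@eq_from_nth _ 0%N).
  by rewrite size_word.
move=> i; rewrite size_word => lti.
by rewrite (nth_word (A := mkperm (perm inj)) (Ordinal lti)) /= permE.
Qed.

Lemma skewA : associative skew.
Proof.
move=> A B D; apply: word_inj.
rewrite !word_skew map_cat -map_comp -!catA; congr (_ ++ _).
by apply: eq_map => x /=; rewrite /psize /= addnCA addnA.
Qed.

Lemma skew0p A : skew perm0 A = A.
Proof. by apply: word_inj; rewrite word_skew word_perm0. Qed.

Lemma skewp0 A : skew A perm0 = A.
Proof.
by apply: word_inj; rewrite word_skew word_perm0 cats0 /= map_id.
Qed.

Lemma skew_decomposition_exists A : exists cs, is_skew_decomposition A cs.
Proof.
have [n] := ubnP (psize A); elim: n A => // n IH A ltAn.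
have [A0|A0] := posnP (psize A).
  exists [::]; split => //; apply: word_inj; rewrite word_perm0.
  by apply: size0nil; rewrite size_word.
have [iA|] := pselect (skew_indecomposable A).
  by exists [:: A]; split => [|B]; rewrite /= ?skewp0 // inE => /eqP ->.
move=> niA; have [B [B' [AE B0 B'0]]] : exists B B',
    [/\ A = skew B B', (0 < psize B)%N & (0 < psize B')%N].
  apply: contra_notP niA => H; split=> // B B' AE.
  have [->|B0] := posnP (psize B); first by left.
  have [->|B'0] := posnP (psize B'); first by right.
  by case: H; exists B, B'.
have sA : psize A = (psize B + psize B')%N by rewrite AE.
have [|cs [BE iB]] := IH B.
  by apply: leq_trans (_ : psize A <= n)%N => //; rewrite sA -addn1 leq_add2l.
have [|cs' [B'E iB']] := IH B'.
  by apply: leq_trans (_ : psize A <= n)%N => //; rewrite sA -add1n leq_add2r.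
exists (cs ++ cs'); split; last first.
  by move=> x; rewrite mem_cat => /orP[/iB|/iB'].
rewrite foldr_cat -B'E AE BE; elim: (cs) => /= [|x s IHs].
  exact: skew0p.
by rewrite -IHs skewA.
Qed.

Lemma skew_eq_psize A B A' B' : skew_indecomposable A -> skew_indecomposable A' ->
  skew A B = skew A' B' -> (psize A' <= psize A)%N.
Proof.
move=> [A0 _] [A'0 iA'] E; rewrite leqNgt; apply/negP => ltA.
have sE : (psize A + psize B = psize A' + psize B')%N := congr1 psize E.
pose d := (psize A' - psize A)%N.
have sA' : psize A' = (psize A + d)%N by rewrite subnKC // ltnW.
have sB : psize B = (d + psize B')%N.
  by apply/eqP; rewrite -(eqn_add2l (psize A)) sE sA' addnA.
have wE := congr1 word E; rewrite !word_skew in wE.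
pose u := drop (psize A) (word A').
have wA' : word A' = map (addn d) (word A) ++ u.
  rewrite -[LHS](cat_take_drop (psize A)); congr (_ ++ _).
  have inj : injective (addn (psize B')) by exact: addnI.
  apply: (inj_map inj); rewrite map_take -map_comp.
  have := congr1 (take (psize A)) wE.
  have le_s : (psize A <= size (map (addn (psize B')) (word A')))%N.
    by rewrite size_map size_word ltnW.
  have eq_s : size (map (addn (psize B)) (word A)) = psize A.
    by rewrite size_map size_word.
  rewrite (take_size_cat _ eq_s) (takel_cat _ le_s) => <-.
  by apply: eq_map => x /=; rewrite sB addnA [(d + _)%N]addnC.
have su : size u = d by rewrite size_drop size_word.
have /word_surj[U UE] : perm_eq u (iota 0 (size u)).
  have := perm_word A'; rewrite wA' su sA' addnC iotaD add0n => H.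
  rewrite -(perm_cat2l (map (addn d) (word A))) (perm_trans H) //.
  rewrite perm_catC perm_cat2r perm_sym.
  by have := perm_map (addn d) (perm_word A); rewrite -iotaDl addn0.
have sU : psize U = d by rewrite -size_word UE.
have [||/eqP] := iA' A U.
- by apply: word_inj; rewrite word_skew UE sU.
- by move=> H; rewrite H in A0.
- by rewrite sU subn_eq0 leqNgt ltA.
Qed.

Lemma skew_decomposition_uniq A cs cs' :
  is_skew_decomposition A cs -> is_skew_decomposition A cs' -> cs = cs'.
Proof.
elim: cs A cs' => [|B bs IH] A [|B' bs'] [AE iA] [AE' iA'] //.
- have [sB _] := iA' B' (mem_head _ _).
  have := congr1 psize AE'; rewrite AE /psize /= => /esym/eqP.
  by rewrite addn_eq0 -/(psize B') eqn0Ngt sB.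
- have [sB _] := iA B (mem_head _ _).
  have := congr1 psize AE; rewrite AE' /psize /= => /esym/eqP.
  by rewrite addn_eq0 -/(psize B) eqn0Ngt sB.
have E : skew B (foldr skew perm0 bs) = skew B' (foldr skew perm0 bs').
  by rewrite -[LHS]AE.
have iB := iA B (mem_head _ _); have iB' := iA' B' (mem_head _ _).
have sB : psize B = psize B'.
  apply/eqP; rewrite eqn_leq (skew_eq_psize iB iB' E).
  by rewrite (skew_eq_psize iB' iB (esym E)).
have := congr1 psize E.
rewrite /psize /= -!/(psize _) sB => /addnI st.
have := congr1 word E; rewrite !word_skew st => /eqP.
rewrite eqseq_cat; last by rewrite !(size_map (addn _)) !size_word.
move=> /andP[/eqP wB /eqP wt].
rewrite (word_inj (inj_map (@addnI _) wB)).
congr cons; apply: (IH (foldr skew perm0 bs)); split=> //.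
- by move=> x xb; apply: iA; rewrite inE xb orbT.
- exact: word_inj.
- by move=> x xb; apply: iA'; rewrite inE xb orbT.
Qed.

Lemma skew_componentsP A : is_skew_decomposition A (skew_components A).
Proof. exact: xgetPex (skew_decomposition_exists A). Qed.

(* Main.v *)
(* A cell with c skew components is a c-tuple of skew indecomposable cells, and
   the weight z^|C| is a product over this tuple.  Both placement counts are
   nondecreasing in each component size: stretching the components extends to a
   strictly increasing map of the axis that sends gates to gates, and composing
   with it injects admissible placements.  Harris' inequality (Chebyshev's sum
   inequality, iterated over the components) then gives the bound with the
   total weight q of the indecomposable cells in place of Q(z).  Finally
   q <= Q(z), since deleting the first (213) or last (132) point of an
   indecomposable cell leaves an arbitrary avoider of the same class.  All of
   this is carried out for cells with components of bounded size, where the sums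
   are finite. *)
From Pilot Require Import Defs.
From mathcomp Require Import all_boot all_order all_algebra all_fingroup.
From mathcomp Require Import all_classical all_reals all_analysis.
From mathcomp Require Import ring lra zify.
Set Implicit Arguments.
Unset Strict Implicit.
Unset Printing Implicit Defensive.
Import Order.TTheory GRing.Theory Num.Theory.
(* The libraries above shadow [basis] and [skew]. *)
Import Pilot.Defs.

(** * Monotonicity of placement counts *)

(** Each component of [w] is translated to the start of the matching component of [w'], so offsets
    from the left gate are kept. Beyond the last gate the map is again a translation, which makes it
    strictly increasing on all of [nat]. *)
Fixpoint gate_map (w w' : seq nat) (x : nat) : nat :=
  match w, w' with
  | a :: u, b :: u' => if x < a then x else b + gate_map u u' (x - a)
  | _, _ => x
  end.

Lemma gate_map_homo w w' : all2 leq w w' ->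
  {homo gate_map w w' : x y / x < y}.
Proof.
elim: w w' => [|a w IH] [|b w'] //=; first by move=> _ x y.
move=> /andP[ab ww'] x y xy.
case: (ltnP x a) => xa; case: (ltnP y a) => ya //.
(* Here [x < a <= y]: the image of [x] is [x < a <= b], and that of [y] is at least [b]. *)
- by apply: ltn_addr; apply: leq_trans xa ab.
- by have := leq_ltn_trans xa (ltn_trans xy ya); rewrite ltnn.
- by rewrite ltn_add2l IH // ltn_sub2r // (leq_ltn_trans xa).
Qed.

Lemma gates_cons a w : gates (a :: w) = 0 :: map (addn a) (gates w).
Proof.
have -> : gates (a :: w) =
    [seq sumn (take i (a :: w)) | i <- 0 :: map (addn 1) (iota 0 (size w).+1)].
  by rewrite -iotaDl.
by rewrite /gates map_cons -!map_comp take0.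
Qed.

Lemma gate_map_gates w w' x : size w = size w' ->
  x \in gates w -> gate_map w w' x \in gates w'.
Proof.
elim: w w' x => [|a w IH] [|b w'] x //= [sw].
rewrite !gates_cons in_cons => /orP[/eqP->|/mapP[y yw ->]].
  (* The gate 0 stays in place unless [a = 0]; then it is also the first gate of the tail and moves
     to [b] plus its image there. *)
  case: (posnP a) => [_|//]; rewrite in_cons sub0n (mem_map (@addnI b)).
  by rewrite IH ?orbT //; apply/mapP; exists 0; rewrite // take0.
rewrite ifF; last by rewrite ltnNge leq_addr.
by rewrite addKn in_cons (mem_map (@addnI b)) IH ?orbT.
Qed.

Lemma gate_map_sumn w w' : size w = size w' ->
  gate_map w w' (sumn w) = sumn w'.
Proof.
elim: w w' => [|a w IH] [|b w'] //=.
move=> [sw]; by rewrite ltnNge leq_addr /= addKn IH.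
Qed.

Lemma num_placements_homo w w' m (key : 'I_m -> nat) (S : {set 'I_m}) :
  all2 leq w w' ->
  num_placements (sumn w) w key S <= num_placements (sumn w') w' key S.
Proof.
move=> ww'; have sw : size w = size w' by move: ww'; rewrite all2E => /andP[/eqP].
have lt_phi := gate_map_homo ww'.
have le_phi : {homo gate_map w w' : x y / x <= y}.
  by move=> x y; rewrite leq_eqVlt => /orP[/eqP->//|/lt_phi/ltnW].
(* The map is increasing and sends the end of one axis to the end of the other. *)
have bound (x : 'I_(sumn w).+1) : gate_map w w' x < (sumn w').+1.
  by rewrite ltnS -(gate_map_sumn sw) le_phi // -ltnS.
pose phi x := Ordinal (bound x).
pose Phi (f : {ffun 'I_m -> 'I_(sumn w).+1}) := [ffun i => phi (f i)].
have phi_inj : injective phi.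
  move=> x y /(congr1 val) /= E; apply: val_inj => /=.
  by case: (ltngtP x y) => // /lt_phi; rewrite E ltnn.
have Phi_inj : injective Phi.
  move=> f g /ffunP E; apply/ffunP => i; apply: phi_inj.
  by have := E i; rewrite !ffunE.
rewrite /num_placements -(card_imset _ Phi_inj); apply: subset_leq_card.
apply/fintype.subsetP => _ /imsetP[f + ->]; rewrite !inE => /andP[mono inG].
apply/andP; split.
  apply/forallP => i; apply/forallP => j; apply/implyP => kij.
  rewrite !ffunE /= le_phi //.
  by move/forallP/(_ i)/forallP/(_ j): mono; rewrite kij.
apply/forall_inP => i iS; rewrite ffunE /= gate_map_gates //.
by move/forall_inP: inG; apply.
Qed.

Lemma all2_rev (T : Type) (r : T -> T -> bool) s t :
  all2 r s t -> all2 r (rev s) (rev t).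
Proof.
rewrite !all2E !size_rev => /andP[/eqP st]; rewrite st eqxx /=.
by rewrite -rev_zip // all_rev.
Qed.

(** * Harris' inequality *)

Local Open Scope ring_scope.

(* The difference of the two sides is half of the sum over pairs of
   a i * a j * (F i - F j) * (G i - G j). *)
Lemma chebyshev_sum (R : realFieldType) (I : Type) (s : seq I) (a F G : I -> R) :
  (forall i, 0 <= a i) -> (forall i j, 0 <= (F i - F j) * (G i - G j)) ->
  (\sum_(i <- s) a i * F i) * (\sum_(i <- s) a i * G i) <=
  (\sum_(i <- s) a i) * (\sum_(i <- s) a i * (F i * G i)).
Proof.
move=> a0 FG; rewrite -subr_ge0.
set X := (X in 0 <= X).
suff E : 2 * X = \sum_(i <- s) \sum_(j <- s)
    a i * a j * ((F i - F j) * (G i - G j)).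
  rewrite -(pmulr_rge0 _ (ltr0n R 2)) E; apply: sumr_ge0 => i _.
  by apply: sumr_ge0 => j _; apply: mulr_ge0 => //; apply: mulr_ge0.
have -> : 2 * X =
  (\sum_(i <- s) a i * (F i * G i)) * (\sum_(j <- s) a j) -
  (\sum_(i <- s) a i * F i) * (\sum_(j <- s) a j * G j) -
  (\sum_(i <- s) a i * G i) * (\sum_(j <- s) a j * F j) +
  (\sum_(i <- s) a i) * (\sum_(j <- s) a j * (F j * G j)).
  by rewrite /X; ring.
rewrite !big_distrlr /= -!sumrB -big_split /=; apply: eq_bigr => i _.
rewrite -!sumrB -big_split /=; apply: eq_bigr => j _; ring.
Qed.

(** This is the integral of [f] against the [c]-fold product of the unnormalised measure [a] on [s],
    seen through [p]. Integrating out one coordinate at a time matches the induction in Harris'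
    inequality. *)
Fixpoint iterated_sum (R : pzRingType) (I : Type) (s : seq I) (a : I -> R)
    (p : I -> nat) (c : nat) (f : seq nat -> R) : R :=
  if c is c'.+1 then
    \sum_(i <- s) a i * iterated_sum s a p c' (fun w => f (p i :: w))
  else f [::].

Definition coord_homo (R : porderType ring_display) (f : seq nat -> R) :=
  forall w w', all2 leq w w' -> f w <= f w'.

Section IteratedSum.
Variables (R : realFieldType) (I : Type) (s : seq I) (a : I -> R) (p : I -> nat).
Hypothesis a_ge0 : forall i, 0 <= a i.
Notation S := (iterated_sum s a p).

Lemma iterated_sum_le c (f g : seq nat -> R) :
  (forall w, f w <= g w) -> S c f <= S c g.
Proof.
elim: c f g => [|c IH] f g fg /=; first exact: fg.
by apply: ler_sum => i _; rewrite ler_wpM2l // IH.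
Qed.

Lemma coord_homo_cons n (f : seq nat -> R) :
  coord_homo f -> coord_homo (fun w => f (n :: w)).
Proof. by move=> hf w w' ww'; apply: hf; rewrite /= leqnn. Qed.

Lemma iterated_sum_cons_le c m n (f : seq nat -> R) : coord_homo f -> (m <= n)%N ->
  S c (fun w => f (m :: w)) <= S c (fun w => f (n :: w)).
Proof.
move=> hf mn; apply: iterated_sum_le => w; apply: hf => /=.
by rewrite mn; elim: w => //= x w ->; rewrite leqnn.
Qed.

(** Induction on [c]. For a fixed first coordinate [i], the sums over the other coordinates are
    nondecreasing in [p i], so Chebyshev applies to them and yields one factor of total weight. The
    induction hypothesis then treats each slice and yields the remaining factors. *)
Lemma harris c (f g : seq nat -> R) : coord_homo f -> coord_homo g ->
  S c f * S c g <= (\sum_(i <- s) a i) ^+ c * S c (fun w => f w * g w).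
Proof.
elim: c f g => [|c IH] f g hf hg /=; first by rewrite expr0 mul1r.
apply: le_trans (chebyshev_sum _ a_ge0 _) _ => [i j|].
  have [ij|/ltnW ij] := leqP (p i) (p j).
    by rewrite mulr_le0 // subr_le0 iterated_sum_cons_le.
  by rewrite mulr_ge0 // subr_ge0 iterated_sum_cons_le.
rewrite exprS -mulrA ler_wpM2l ?sumr_ge0 // mulr_sumr; apply: ler_sum => i _.
by rewrite [leRHS]mulrCA ler_wpM2l // IH //; exact: coord_homo_cons.
Qed.

End IteratedSum.

Local Close Scope ring_scope.

(** * Pattern avoidance and skew sums *)

(** The arguments are three values read from left to right. *)
Definition forbidden (k : cell_kind) (x y t : nat) : bool :=
  match k with
  | Av213 => y < x < t
  | Av132 => x < t < y
  end.

Definition avoids (k : cell_kind) (w : seq nat) : Prop :=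
  forall i j l, i < j -> j < l -> l < size w ->
    ~~ forbidden k (nth 0 w i) (nth 0 w j) (nth 0 w l).

Lemma ord3P (P : 'I_3 -> Prop) :
  P (inord 0) -> P (inord 1) -> P (inord 2) -> forall i, P i.
Proof.
move=> P0 P1 P2 i; rewrite -(inord_val i).
by case: i => [[|[|[|//]]] ?].
Qed.

Lemma basisE k (i : 'I_3) :
  basis k i = nth 0 (if k is Av213 then [:: 1; 0; 2] else [:: 0; 2; 1]) i :> nat.
Proof.
by case: k; elim/ord3P: i; rewrite /= permE /= -!val_eqE /= !inordK //= !inordK.
Qed.

Lemma in_classP k A : in_class k A <-> avoids k (word A).
Proof.
split=> [+ i j l ij jl|avo].
  rewrite size_word => /negP nc ls; apply/negP => bad; apply: nc.
  have js := ltn_trans jl ls; have is_ := ltn_trans ij js.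
  pose o := [:: Ordinal is_; Ordinal js; Ordinal ls].
  apply/existsP; exists [ffun a : 'I_3 => nth (Ordinal is_) o a].
  have wE (a : 'I_(psize A)) : (tagged A a : nat) = nth 0 (word A) a.
    by rewrite nth_word.
  apply/forallP => a; apply/forallP => b; rewrite !ffunE !basisE !wE.
  move: bad.
  elim/ord3P: a; elim/ord3P: b; rewrite !inordK //= ?ltnn //; case: (k) => /=; lia.
apply/negP => /existsP[f /forallP H].
have wE (a : 'I_3) : (tagged A (f a) : nat) = nth 0 (word A) (f a).
  by rewrite nth_word.
have Hij a b := andP (forallP (H a) b).
have [/implyP H01 /eqP K01] := Hij (inord 0) (inord 1).
have [/implyP H12 /eqP K12] := Hij (inord 1) (inord 2).
have [_ /eqP K02] := Hij (inord 0) (inord 2).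
have [_ /eqP K10] := Hij (inord 1) (inord 0).
have [_ /eqP K21] := Hij (inord 2) (inord 1).
have := avo (f (inord 0)) (f (inord 1)) (f (inord 2)).
rewrite size_word ltn_ord H01 ?H12 ?inordK // => /(_ isT isT isT).
move: K01 K12 K02 K10 K21; rewrite !basisE !wE !inordK //.
by case: (k) => /=; lia.
Qed.

(** This common feature of 213 and 132 makes both classes closed under skew sums: an occurrence
    straddling the two summands would start in the upper one and end in the lower one. *)
Lemma forbidden_lt k x y t : forbidden k x y t -> x < t.
Proof. by case: k => /=; lia. Qed.

Lemma avoids_cat k (u v : seq nat) m :
  {in u, forall x, m <= x} -> {in v, forall x, x < m} ->
  avoids k (u ++ v) <-> avoids k u /\ avoids k v.
Proof.
move=> um vm; split=> [avo|[au av]].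
  split=> i j l ij jl ls.
    have := avo i j l ij jl; rewrite size_cat ltn_addr // => /(_ isT).
    by rewrite !nth_cat ls (ltn_trans jl ls) (ltn_trans ij (ltn_trans jl ls)).
  have := avo (size u + i) (size u + j) (size u + l).
  rewrite !ltn_add2l size_cat ltn_add2l => /(_ ij jl ls).
  by rewrite !nth_cat !ltnNge !leq_addr /= !addKn.
move=> i j l ij jl; rewrite size_cat => ls; apply/negP => bad.
have := forbidden_lt bad; move: bad; rewrite !nth_cat.
have [lu|ul] := ltnP l (size u).
  rewrite (ltn_trans jl lu) (ltn_trans ij (ltn_trans jl lu)) => bad _.
  by have := au i j l ij jl lu; rewrite bad.
have lv : l - size u < size v by lia.
have [iu|ui] := ltnP i (size u) => bad.
  have := um _ (mem_nth 0 iu); have := vm _ (mem_nth 0 lv) => /=; lia.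
move: bad; rewrite ifF; last by lia.
move=> bad _; have := av (i - size u) (j - size u) (l - size u).
rewrite bad => H; suff : false by [].
by apply: H; lia.
Qed.

Lemma avoids_mono k (f : nat -> nat) w : {mono f : x y / x < y} ->
  avoids k (map f w) <-> avoids k w.
Proof.
move=> mf; split=> avo i j l ij jl.
  move=> ls; have := avo i j l ij jl; rewrite size_map => /(_ ls).
  by rewrite !(nth_map 0) ?mf; [case: (k) => /=; rewrite !mf|lia..].
rewrite size_map => ls; rewrite !(nth_map 0); [|lia..].
by have := avo i j l ij jl ls; case: (k) => /=; rewrite !mf.
Qed.

Lemma mem_word A x : (x \in word A) = (x < psize A).
Proof. by rewrite (perm_mem (perm_word A)) mem_iota. Qed.

Lemma in_class_skew k A B : in_class k (skew A B) <-> in_class k A /\ in_class k B.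
Proof.
rewrite !in_classP word_skew (@avoids_cat _ _ _ (psize B)).
- by rewrite avoids_mono // => x y; rewrite ltn_add2l.
- by move=> _ /mapP[x _ ->]; rewrite leq_addr.
- by move=> x; rewrite mem_word.
Qed.

(** * Skew indecomposable avoiders *)

Lemma uniq_word A : uniq (word A).
Proof. by rewrite (perm_uniq (perm_word A)) iota_uniq. Qed.

Lemma word_iotaP u : uniq u -> {in u, forall x, x < size u} ->
  exists A, word A = u.
Proof.
move=> uu lu; apply: word_surj; apply: uniq_perm; rewrite ?iota_uniq //.
apply: (uniq_min_size uu _ _).2; last by rewrite size_iota.
by move=> x /lu; rewrite mem_iota.
Qed.

Lemma word_cat_skew A (u v : seq nat) t : word A = u ++ v -> t <= psize A ->
  {in u, forall x, t <= x} -> {in v, forall x, x < t} ->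
  exists B B', [/\ A = skew B B', psize B = size u & psize B' = size v].
Proof.
move=> wA tA ut vt.
have := uniq_word A; rewrite wA cat_uniq => /and3P[uu _ uv].
have sA : size u + size v = psize A by rewrite -size_cat -wA size_word.
(* The entries below [t] are counted twice: in [u ++ v] they are those of [v], and in
   [iota 0 (psize A)] there are [t] of them. *)
have sv : size v = t.
  have : count (fun x => x < t) (word A) = count (fun x => x < t) (iota 0 (psize A)).
    by move/seq.permP: (perm_word A); apply.
  rewrite wA -(subnKC tA) iotaD !count_cat.
  have /eq_in_count-> : {in u, (fun x => x < t) =1 pred0}.
    by move=> x /ut; rewrite ltnNge => ->.
  have /eq_in_count-> : {in v, (fun x => x < t) =1 predT} by move=> x /vt.
  have /eq_in_count-> : {in iota 0 t, (fun x => x < t) =1 predT}.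
    by move=> x; rewrite mem_iota.
  have /eq_in_count-> : {in iota (0 + t) (psize A - t), (fun x => x < t) =1 pred0}.
    by move=> x; rewrite mem_iota add0n => /andP[tx _]; rewrite ltnNge tx.
  by rewrite !count_pred0 !count_predT size_iota addn0.
have [B' wB'] : exists B', word B' = v.
  by apply: word_iotaP => // x /vt; rewrite sv.
have [B wB] : exists B, word B = map (subn^~ t) u.
  apply: word_iotaP.
    by rewrite map_inj_in_uniq // => x y /ut tx /ut ty; lia.
  move=> _ /mapP[x xu ->]; rewrite size_map; have := ut x xu.
  have : x < psize A by rewrite -mem_word wA mem_cat xu.
  by lia.
have sB : psize B = size u by rewrite -size_word wB size_map.
have sB' : psize B' = size v by rewrite -size_word wB'.
exists B, B'; split=> //; apply: word_inj; rewrite word_skew wA wB wB'.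
congr (_ ++ _); rewrite -map_comp -[LHS]map_id; apply/eq_in_map => x /ut /=.
by lia.
Qed.

(** A position separating the values at least [t] from the smaller ones cuts [A] as a skew sum, so
    one side is empty. It is used below with [t] the first value, and with [t] one more than the
    last value. *)
Lemma indecomposable_threshold A t j : skew_indecomposable A ->
  t <= psize A -> j <= psize A ->
  (forall i, i < j -> t <= nth 0 (word A) i) ->
  (forall i, j <= i -> i < psize A -> nth 0 (word A) i < t) ->
  j = 0 \/ j = psize A.
Proof.
move=> [A0 iA] tA jA lo hi.
have [||B [B' [AE sB sB']]] :=
    word_cat_skew (esym (cat_take_drop j (word A))) tA.
- move=> x /(nthP 0)[i]; rewrite size_takel ?size_word // => ij <-.
  by rewrite nth_take // lo.
- move=> x /(nthP 0)[i]; rewrite size_drop size_word => si <-.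
  by rewrite nth_drop hi; lia.
have := iA _ _ AE; rewrite sB sB' size_drop size_takel ?size_word //.
by case; lia.
Qed.

(** Inverse of the deletion of a point: a new minimum in front for 213, a new maximum at the end for
    132. *)
Definition grow (k : cell_kind) (w : seq nat) : seq nat :=
  match k with
  | Av213 => 0 :: map S w
  | Av132 => rcons w (size w)
  end.

Lemma size_grow k w : size (grow k w) = (size w).+1.
Proof. by case: k => /=; rewrite ?size_map ?size_rcons. Qed.

Lemma avoids_grow k w : avoids k (grow k w) -> avoids k w.
Proof.
case: k => /= avo.
  apply/(@avoids_mono _ S); first by move=> x y; rewrite ltnS.
  by move=> i j l ij jl ls; have := avo i.+1 j.+1 l.+1 ij jl ls.
move=> i j l ij jl ls; have := avo i j l ij jl.
rewrite size_rcons !nth_rcons ls (ltn_trans jl ls) (ltn_trans ij (ltn_trans jl ls)).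
by apply; exact: ltnW.
Qed.

(* The first value of an indecomposable 213-avoider is its minimum, since the
   points below that value form a suffix. *)
Lemma head_indecomposable213 A : skew_indecomposable A -> in_class Av213 A ->
  nth 0 (word A) 0 = 0.
Proof.
move=> iA /in_classP avo; have A0 := iA.1; set w := word A in avo *.
have sw : size w = psize A := size_word A.
set v := nth 0 w 0; pose j := find (fun x => x < v) w.
have jA : j <= psize A by rewrite -sw find_size.
have vA : v < psize A by rewrite -mem_word mem_nth // sw.
have j0 : 0 < j.
  rewrite lt0n; apply/eqP => j0.
  have := @nth_find _ 0 (fun x => x < v) w.
  by rewrite has_find -/j j0 sw A0 ltnn => /(_ isT).
have lo i : i < j -> v <= nth 0 w i.
  by move=> /(before_find 0)/= H; rewrite leqNgt H.
have hi i : j <= i -> i < psize A -> nth 0 w i < v.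
  move=> ji iA'; have jA' := leq_ltn_trans ji iA'.
  have wj : nth 0 w j < v by apply: (@nth_find _ 0 (fun x => x < v)); rewrite has_find sw.
  move: ji; rewrite leq_eqVlt => /orP[/eqP<-//|ji].
  rewrite ltnNge leq_eqVlt; apply/negP => /orP[|wi].
    by rewrite nth_uniq ?sw ?uniq_word //; lia.
  (* The value [v] at position 0, a smaller one at [j] and a larger one at [i] form a 213. *)
  by have := avo 0 j i j0 ji; rewrite sw => /(_ iA'); rewrite /= wj wi.
have [E|E] := indecomposable_threshold iA (ltnW vA) jA lo hi.
  by rewrite E in j0.
(* Now [j = psize A], so no entry lies below [v]; since 0 is an entry, [v = 0]. *)
have /(nthP 0)[i + i0] : 0 \in w by rewrite mem_word.
by rewrite sw -E => /lo; rewrite i0 leqn0 => /eqP.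
Qed.

(* The last value of an indecomposable 132-avoider is its maximum, since the
   points above that value form a prefix. *)
Lemma last_indecomposable132 A : skew_indecomposable A -> in_class Av132 A ->
  nth 0 (word A) (psize A).-1 = (psize A).-1.
Proof.
move=> iA /in_classP avo; have A0 := iA.1; set w := word A in avo *.
have sw : size w = psize A := size_word A.
set m := (psize A).-1; have mA : m < psize A by rewrite /m; lia.
set v := nth 0 w m; pose j := find (fun x => x <= v) w.
have vA : v < psize A by rewrite -mem_word mem_nth // sw.
have hj : has (fun x => x <= v) w by apply/(has_nthP 0); exists m; rewrite ?sw.
have jA : j < psize A by rewrite -sw -has_find.
have lo i : i < j -> v.+1 <= nth 0 w i.
  by move=> /(before_find 0)/= H; rewrite ltnNge H.
have wj : nth 0 w j <= v by exact: (@nth_find _ 0 (fun x => x <= v)).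
have hi i : j <= i -> i < psize A -> nth 0 w i < v.+1.
  move=> ji iA'; rewrite ltnS leqNgt; apply/negP => wi.
  have jm : (nth 0 w j == v) = (j == m) by rewrite nth_uniq ?sw ?uniq_word.
  have ij : i != j by apply/eqP => E; move: wi; rewrite E; lia.
  have im : i != m by apply/eqP => E; move: wi; rewrite E ltnn.
  have ltim : i < m by rewrite /m in im *; lia.
  have ltji : j < i by lia.
  (* As [j < m], the value at [j] is strictly below [v], so positions [j], [i], [m] form a 132. *)
  have := avo j i m ltji ltim; rewrite sw -/v => /(_ mA) /=.
  by rewrite wi andbT ltn_neqAle jm wj andbT negbK; lia.
have [E|E] := indecomposable_threshold iA vA (ltnW jA) lo hi.
(* With [j = 0] all values are at most [v], and the largest possible value [m] occurs. *)
- have /(nthP 0)[i] : m \in w by rewrite mem_word.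
  rewrite sw => iA' wi; have := hi i; rewrite E wi => /(_ isT iA').
  by rewrite /m; lia.
- by lia.
Qed.

Lemma indecomposable_grow k A : skew_indecomposable A -> in_class k A ->
  exists2 L, in_class k L & word A = grow k (word L).
Proof.
move=> iA cA; have A0 := iA.1.
suff [L wA] : exists L, word A = grow k (word L).
  exists L => //; apply/in_classP; apply: avoids_grow; rewrite -wA.
  exact/in_classP.
have sw := size_word A; have uw := uniq_word A.
have mw x : x \in word A -> x < psize A by rewrite mem_word.
case: k cA => cA.
  have w0 := head_indecomposable213 iA cA.
  case: (word A) sw uw mw w0 => [|x w] /= sw; first by rewrite -sw in A0.
  move=> /andP[xw uw] mw x0; rewrite {}x0 in xw mw *.
  (* The deleted value is 0, so the other values are positive and can be lowered by one. *)
  have wE : map S (map predn w) = w.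
    rewrite -map_comp -[RHS]map_id; apply/eq_in_map => y yw /=.
    by rewrite prednK // lt0n; apply: contraNneq xw => <-.
  have [|y|L wL] := @word_iotaP (map predn w).
  - by rewrite -(map_inj_uniq succn_inj) wE.
  - move=> /mapP[z zw ->]; rewrite size_map -ltnS prednK.
      by rewrite sw mw // inE zw orbT.
    by rewrite lt0n; apply: contraNneq xw => <-.
  by exists L; rewrite wL wE.
have wl := last_indecomposable132 iA cA.
case/lastP: (word A) sw uw mw wl => [|w x]; rewrite ?size_rcons => sw.
  by rewrite -sw in A0.
rewrite rcons_uniq -sw nth_rcons ltnn eqxx /= => /andP[xw uw] mw xE.
have [|y yw|L wL] := @word_iotaP w => //.
  have := mw y; rewrite mem_rcons inE yw orbT ltnS leq_eqVlt => /(_ isT).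
  by case/orP=> [/eqP yE|//]; rewrite xE -yE yw in xw.
by exists L; rewrite wL -xE.
Qed.

(** * Cells with bounded components *)

Definition perms_upto (N : nat) : seq permutation :=
  [seq mkperm s | n <- iota 0 N.+1, s <- enum 'S_n].

Lemma mem_perms_upto N A : (A \in perms_upto N) = (psize A <= N).
Proof.
apply/allpairsPdep/idP => [[n [s [+ _ ->]]]|AN]; first by rewrite mem_iota.
by exists (psize A), (tagged A); rewrite mem_iota mem_enum; case: A AN.
Qed.

Lemma perms_upto_uniq N : uniq (perms_upto N).
Proof.
apply: allpairs_uniq_dep => [|n _|]; rewrite ?iota_uniq ?enum_uniq //.
by move=> [n s] [m t] _ _ /= E; exact: E.
Qed.

Definition avoiders k N : seq permutation :=
  [seq A <- perms_upto N | `[< in_class k A >]].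

Definition indecomposables k N : seq permutation :=
  [seq A <- perms_upto N | `[< skew_indecomposable A /\ in_class k A >]].

Lemma mem_avoiders k N A : (A \in avoiders k N) <-> in_class k A /\ psize A <= N.
Proof.
by rewrite mem_filter mem_perms_upto; split=> [/andP[/asboolP]|[/asboolP-> ->]].
Qed.

Lemma mem_indecomposables k N A : (A \in indecomposables k N) <->
  [/\ skew_indecomposable A, in_class k A & psize A <= N].
Proof.
rewrite mem_filter mem_perms_upto; split=> [/andP[/asboolP[]]//|[iA cA ->]].
by rewrite andbT; apply/asboolP.
Qed.

Lemma skew_components_skew A B : skew_indecomposable A ->
  skew_components (skew A B) = A :: skew_components B.
Proof.
move=> iA; apply: skew_decomposition_uniq (skew_componentsP _) _.
have [BE iB] := skew_componentsP B; split; first by rewrite /= -BE.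
by move=> x; rewrite inE => /orP[/eqP->|/iB].
Qed.

Lemma skew_components0 : skew_components perm0 = [::].
Proof. by apply: skew_decomposition_uniq (skew_componentsP _) _; split. Qed.

Lemma in_class0 k : in_class k perm0.
Proof. by apply/in_classP => i j l _ _; rewrite word_perm0. Qed.

Lemma skew_indecomposable_inj A A' B B' :
  skew_indecomposable A -> skew_indecomposable A' ->
  skew A B = skew A' B' -> A = A' /\ B = B'.
Proof.
move=> iA iA' E; have := congr1 skew_components E.
rewrite !skew_components_skew // => -[AA' BB']; split=> //.
by rewrite (skew_componentsP B).1 (skew_componentsP B').1 BB'.
Qed.

Lemma skew_components_ind (P : permutation -> Prop) : P perm0 ->
  (forall A B, skew_indecomposable A -> P B -> P (skew A B)) -> forall A, P A.
Proof.
move=> P0 PS A; have := skew_componentsP A.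
move: (skew_components A) => cs [->]; elim: cs => //= B cs IH iB.
apply: PS; first exact: iB (mem_head _ _).
by apply: IH => x xcs; apply: iB; rewrite inE xcs orbT.
Qed.

(** The bound [N] applies to each component and not to the whole cell, so the components vary
    independently and sums over these cells are exactly iterated sums. *)
Fixpoint cells k N c : seq permutation :=
  if c is c'.+1 then [seq skew A B | A <- indecomposables k N, B <- cells k N c']
  else [:: perm0].

Lemma cells_connecting k N c C : C \in cells k N c -> connecting_cells k c C.
Proof.
elim: c C => [|c IH] C /=.
  by rewrite inE => /eqP->; split; rewrite ?skew_components0 //; exact: in_class0.
move=> /allpairsP[[A B] /= [/mem_indecomposables[iA cA _] /IH[cB sB] ->]].
by split; rewrite ?skew_components_skew /= ?sB //; apply/in_class_skew.
Qed.

Lemma connecting_cells_mem k N c C :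
  connecting_cells k c C -> psize C <= N -> C \in cells k N c.
Proof.
elim/skew_components_ind: C c => [|A B iA IH] c [].
  by rewrite skew_components0 => _ <-; rewrite inE.
rewrite skew_components_skew // => /in_class_skew[cA cB] <- /=.
rewrite -/(psize A) -/(psize B) => sN; apply: allpairs_f.
  by apply/mem_indecomposables; split=> //; rewrite (leq_trans _ sN) // leq_addr.
by apply: IH; rewrite // (leq_trans _ sN) // leq_addl.
Qed.

Lemma cells_uniq k N c : uniq (cells k N c).
Proof.
elim: c => //= c IH; apply: allpairs_uniq => //.
  by rewrite filter_uniq // perms_upto_uniq.
move=> [A B] [A' B'] /allpairsP[[x y] /= [xi _ [-> ->]]].
move=> /allpairsP[[x' y'] /= [xi' _ [-> ->]]].
move/mem_indecomposables: xi => [ix _ _]; move/mem_indecomposables: xi' => [ix' _ _].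
by move=> /(skew_indecomposable_inj ix ix')[-> ->].
Qed.

Lemma indecomposables0 k : indecomposables k 0 = [::].
Proof.
apply/eqP; rewrite -size_eq0; case E: (indecomposables k 0) => [|A s] //.
have /mem_indecomposables[[A0 _] _] : A \in indecomposables k 0 by rewrite E; exact: mem_head.
by rewrite leqn0 => /eqP A0'; rewrite A0' in A0.
Qed.

(** The default [perm0] is never taken: the next lemma realises every grown word. *)
Definition grow_perm k (L : permutation) : permutation :=
  xget perm0 [set A | word A = grow k (word L)]%classic.

Lemma word_grow_perm k L : word (grow_perm k L) = grow k (word L).
Proof.
rewrite /grow_perm; case: xgetP => [B _ //|nex]; exfalso.
have [||B wB] := @word_iotaP (grow k (word L)); last exact: (nex B).
- case: (k) => /=.
    rewrite (map_inj_uniq succn_inj) uniq_word andbT.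
    by apply/mapP => -[].
  by rewrite rcons_uniq uniq_word andbT mem_word size_word ltnn.
- move=> x; rewrite size_grow size_word; case: (k) => /=.
    by rewrite inE => /orP[/eqP->//|/mapP[y yw ->]]; rewrite ltnS -mem_word.
  by rewrite mem_rcons inE size_word mem_word -leq_eqVlt ltnS.
Qed.

Lemma indecomposables_sub_grow k N :
  {subset indecomposables k N.+1 <= map (grow_perm k) (avoiders k N)}.
Proof.
move=> A /mem_indecomposables[iA cA sA].
have [L cL wA] := indecomposable_grow iA cA.
apply/mapP; exists L.
  apply/mem_avoiders; split=> //.
  by rewrite -ltnS -size_word -(size_grow k) -wA size_word.
by apply: word_inj; rewrite wA word_grow_perm.
Qed.

(** * Total weights of bounded cells and their comparison with [Q z] *)

Local Open Scope ring_scope.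

Lemma ler_sum_subset (R : numDomainType) (I : eqType) (s t : seq I) (F : I -> R) :
  uniq s -> {subset s <= t} -> (forall i, 0 <= F i) ->
  \sum_(i <- s) F i <= \sum_(i <- t) F i.
Proof.
move=> us st F0; have /count_subseqP[u ut su] := leq_uniq_count us st.
have [v tv] := perm_to_subseq ut.
by rewrite (perm_big _ su) (perm_big _ tv) big_cat lerDl sumr_ge0.
Qed.

Section Mass.
Variables (R : realType) (z : R).
Hypotheses (z_gt0 : 0 < z) (z_lt : z < 1 / 4).

Lemma Q_quadratic : Q z * (1 - Q z) = z.
Proof.
have : 0 <= 1 - 4 * z by have := z_lt; lra.
move=> /sqr_sqrtr E; rewrite /Q; set s := Num.sqrt _ in E *.
have -> : (1 - s) / 2 * (1 - (1 - s) / 2) = (1 - s ^+ 2) / 4 by field.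
by rewrite E; lra.
Qed.

Lemma Q_gt0 : 0 < Q z.
Proof.
have : Num.sqrt (1 - 4 * z) < Num.sqrt 1 by rewrite ltr_sqrt; have := z_gt0; lra.
by rewrite sqrtr1 /Q; lra.
Qed.

Lemma zpow_ge0 n : 0 <= z ^+ n.
Proof. exact/exprn_ge0/ltW. Qed.

Notation mass s := (\sum_(A <- s) z ^+ psize A).

(** A nonempty avoider splits into its first component and an avoider made of the rest, both of size
    at most [N]. The right side also counts skew sums larger than [N], whence an inequality. *)
Lemma mass_avoiders k N :
  mass (avoiders k N) <= 1 + mass (indecomposables k N) * mass (avoiders k N).
Proof.
apply: le_trans
  (_ : _ <= mass (perm0 :: [seq skew A B | A <- indecomposables k N, B <- avoiders k N])) _.
  apply: ler_sum_subset => [|A /mem_avoiders|A]; last exact: zpow_ge0.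
    by rewrite filter_uniq // perms_upto_uniq.
  elim/skew_components_ind: A => [_|A B iA _ [/in_class_skew[cA cB] sN]].
    by rewrite mem_head.
  rewrite inE; apply/orP; right; move: sN; rewrite /psize /=.
  rewrite -/(psize A) -/(psize B) => sN; apply: allpairs_f.
    by apply/mem_indecomposables; split=> //; rewrite (leq_trans _ sN) // leq_addr.
  by apply/mem_avoiders; split; rewrite // (leq_trans _ sN) // leq_addl.
rewrite big_cons expr0 lerD2l big_allpairs_dep mulr_suml; apply: ler_sum => A _.
by rewrite mulr_sumr; apply: ler_sum => B _; rewrite -exprD.
Qed.

Lemma mass_indecomposables_succ k N :
  mass (indecomposables k N.+1) <= z * mass (avoiders k N).
Proof.
apply: le_trans (_ : _ <= mass (map (grow_perm k) (avoiders k N))) _.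
  apply: ler_sum_subset (@indecomposables_sub_grow k N) _ => [|A].
    by rewrite filter_uniq // perms_upto_uniq.
  exact: zpow_ge0.
rewrite big_map mulr_sumr; apply: ler_sum => L _.
by rewrite -exprS -[psize (grow_perm k L)]size_word word_grow_perm size_grow size_word.
Qed.

(* Avoiders A with generating function F satisfy F <= 1 + q F, so q <= Q at one
   stage gives z F <= z / (1 - Q) = Q at the next. *)
Lemma mass_indecomposables_le k N : mass (indecomposables k N) <= Q z.
Proof.
elim: N => [|N IH]; first by rewrite indecomposables0 big_nil ltW // Q_gt0.
apply: le_trans (mass_indecomposables_succ _ _) _.
have FN := mass_avoiders k N; set F := mass (avoiders k N) in FN *.
have F0 : 0 <= F by apply: sumr_ge0 => A _; exact: zpow_ge0.
have : F * (1 - Q z) <= 1.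
  have : mass (indecomposables k N) * F <= Q z * F by rewrite ler_wpM2r.
  by lra.
(* Multiplication by [Q z] turns the factor [1 - Q z] into [z]. *)
move=> /(ler_wpM2l (ltW Q_gt0)); rewrite mulrCA Q_quadratic; lra.
Qed.

Lemma sum_cells k N c (f : seq nat -> R) :
  \sum_(C <- cells k N c) z ^+ psize C * f (component_sizes C) =
  iterated_sum (indecomposables k N) (fun A => z ^+ psize A) psize c f.
Proof.
elim: c f => [|c IH] f /=.
  by rewrite big_seq1 expr0 mul1r /component_sizes skew_components0.
rewrite big_allpairs_dep; apply: eq_big_seq => A /mem_indecomposables[iA _ _].
rewrite -IH mulr_sumr; apply: eq_big_seq => B _.
by rewrite /component_sizes skew_components_skew // mulrA -exprD.
Qed.

Lemma harris_cells k N c (f g : seq nat -> R) :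
  coord_homo f -> coord_homo g -> (forall w, 0 <= f w) -> (forall w, 0 <= g w) ->
  (\sum_(C <- cells k N c) z ^+ psize C * f (component_sizes C)) *
  (\sum_(C <- cells k N c) z ^+ psize C * g (component_sizes C)) <=
  Q z ^+ c * \sum_(C <- cells k N c)
    z ^+ psize C * (f (component_sizes C) * g (component_sizes C)).
Proof.
move=> hf hg f0 g0; rewrite (sum_cells _ _ _ (fun w => f w * g w)) !sum_cells.
apply: le_trans (harris _ _ _ _ hf hg) _ => [A|]; first exact: zpow_ge0.
apply: ler_wpM2r.
  rewrite -(sum_cells _ _ _ (fun w => f w * g w)).
  by apply: sumr_ge0 => C _; rewrite mulr_ge0 ?zpow_ge0 // mulr_ge0.
apply: lerXn2r; rewrite ?nnegrE ?(ltW Q_gt0) ?mass_indecomposables_le //.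
by apply: sumr_ge0 => A _; exact: zpow_ge0.
Qed.

End Mass.

(** * Bounding infinite sums by their finite partial sums *)

Local Open Scope ereal_scope.

Section EsumReal.
Variables (R : realType) (T : choiceType) (S : set T).
Implicit Types (f g : T -> R) (X Y : seq T).

Lemma esum_le_fin f (M : R) :
  (forall X, uniq X -> (forall x, x \in X -> S x) -> (\sum_(x <- X) f x <= M)%R) ->
  (\esum_(x in S) (f x)%:E) <= M%:E.
Proof.
move=> fM; apply: ge_ereal_sup => _ [X [finX XS] <-].
rewrite fsumEFin // fsbig_finite // lee_fin; apply: fM; first exact: finmap.fset_uniq.
by move=> x; rewrite in_fset_set // inE => /XS.
Qed.

Lemma sum_le_esum f X : uniq X -> (forall x, x \in X -> S x) ->
  (\sum_(x <- X) f x)%:E <= \esum_(x in S) (f x)%:E.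
Proof.
move=> uX XS; apply: esum_ge; exists [set` X]%classic.
  by split; [exact: finite_seq|move=> x /= /XS].
by rewrite -fsbig_seq // sumEFin.
Qed.

(** The suprema are taken one factor at a time. A positive partial sum of [f] bounds the sum of [g],
    which is therefore finite; dividing by that sum then bounds every partial sum of [f]. *)
Lemma esum_mul_le f g (K : R) :
  (forall x, 0 <= f x)%R -> (forall x, 0 <= g x)%R -> (0 <= K)%R ->
  (forall X Y, uniq X -> uniq Y ->
    (forall x, x \in X -> S x) -> (forall y, y \in Y -> S y) ->
    ((\sum_(x <- X) f x) * (\sum_(y <- Y) g y) <= K)%R) ->
  (\esum_(x in S) (f x)%:E) * (\esum_(x in S) (g x)%:E) <= K%:E.
Proof.
move=> f0 g0 K0 fgK.
set A := \esum_(x in S) (f x)%:E; set B := \esum_(x in S) (g x)%:E.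
have A0 : 0 <= A by apply: esum_ge0 => x _; rewrite lee_fin.
have B0 : 0 <= B by apply: esum_ge0 => x _; rewrite lee_fin.
have [[X [uX XS X0]]|nX] := pselect (exists X, [/\ uniq X,
    forall x, x \in X -> S x & (0 < \sum_(x <- X) f x)%R]); last first.
  (* No partial sum of [f] is positive; the convention that 0 times infinity is 0 covers an infinite
     [B]. *)
  suff -> : A = 0 by rewrite mul0e.
  apply/eqP; rewrite eq_le A0 andbT; apply: esum_le_fin => X uX XS.
  by rewrite leNgt; apply/negP => X0; apply: nX; exists X.
have BK : B <= (K / \sum_(x <- X) f x)%:E.
  apply: esum_le_fin => Y uY YS.
  by rewrite ler_pdivlMr // mulrC fgK.
have Bfin : B \is a fin_num.
  by rewrite ge0_fin_numE // (le_lt_trans BK) // ltry.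
rewrite -(fineK Bfin); set b := fine B.
have b_ge0 : (0 <= b)%R by exact: fine_ge0.
have [->|b_neq0] := eqVneq b 0%R; first by rewrite mule0 lee_fin.
have b_gt0 : (0 < b)%R by rewrite lt_def b_neq0.
rewrite -lee_pdivlMr // -EFinM; apply: esum_le_fin => X' uX' X'S.
rewrite ler_pdivlMr //.
have : (0 <= \sum_(x <- X') f x)%R by apply: sumr_ge0.
rewrite le_eqVlt => /orP[/eqP<-|X'0]; first by rewrite mul0r.
rewrite mulrC -ler_pdivlMr // -lee_fin fineK //.
apply: esum_le_fin => Y uY YS.
by rewrite ler_pdivlMr // mulrC fgK.
Qed.

End EsumReal.

(** * Passage from bounded cells to all connecting cells *)

Lemma cells_cover k c (X : seq permutation) :
  (forall C, C \in X -> connecting_cells k c C) ->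
  exists N0, forall N, (N0 <= N)%N -> {subset X <= cells k N c}.
Proof.
move=> XS; exists (\max_(C <- X) psize C)%N => N leN C CX.
apply: connecting_cells_mem; first exact: XS.
by apply: leq_trans leN; exact: leq_bigmax_seq.
Qed.

Lemma sumn_component_sizes C : sumn (component_sizes C) = psize C.
Proof.
elim/skew_components_ind: C => [|A B iA IH].
  by rewrite /component_sizes skew_components0.
by rewrite /component_sizes skew_components_skew //= -/(component_sizes B) IH.
Qed.

Theorem theorem3p6 (R : realType) (z : R) (hz0 : (0 < z)%R) (hz1 : (z < 1 / 4)%R)
    (k kh kv : cell_kind) (Dh Dv : permutation)
    (hDh : in_class kh Dh) (hDv : in_class kv Dv)
    (c : nat) (hc : (1 <= c)%N) :
  \esum_(C in connecting_cells k c)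
      (z ^+ psize C * (Nh C kh Dh)%:R * (Nv C kv Dv)%:R)%:E
  >= (\esum_(C in connecting_cells k c) (z ^+ psize C * (Nh C kh Dh)%:R)%:E)
     * (\esum_(C in connecting_cells k c) (z ^+ psize C * (Nv C kv Dv)%:R)%:E)
     / (Q z ^+ c)%:E.
Proof.
pose fh w : R := (num_placements (sumn w) (rev w)
  (fun i : 'I_(psize Dh) => tagged Dh i : nat) (nonleaves kh Dh))%:R.
pose fv w : R := (num_placements (sumn w) w
  (fun i : 'I_(psize Dv) => i : nat) (nonleaves kv Dv))%:R.
have fhE C : (Nh C kh Dh)%:R = fh (component_sizes C).
  by rewrite /fh sumn_component_sizes.
have fvE C : (Nv C kv Dv)%:R = fv (component_sizes C).
  by rewrite /fv sumn_component_sizes.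
have fh_homo : coord_homo fh.
  (* On the value axis the components are read in reverse; this preserves their total size and the
     componentwise order of size lists. *)
  move=> w w' ww'; rewrite ler_nat -(sumn_rev w) -(sumn_rev w').
  exact/num_placements_homo/all2_rev.
have fv_homo : coord_homo fv.
  by move=> w w' ww'; rewrite ler_nat num_placements_homo.
have q0 := Q_gt0 hz0; have qc0 : (0 < Q z ^+ c)%R by exact: exprn_gt0.
have zp n : (0 <= z ^+ n)%R by exact: zpow_ge0.
set D := (X in _ <= X).
have D0 : 0 <= D by apply: esum_ge0 => C _; rewrite lee_fin !mulr_ge0.
rewrite /inve /= gt_eqF // lee_pdivrMr //.
(* If [D] is infinite, so is its product with the positive number [Q z ^+ c], and the bound is
   immediate. *)
have [Dfin|] := boolP (D \is a fin_num); last first.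
  rewrite ge0_fin_numE // -leNgt leye_eq => /eqP->.
  by rewrite gt0_mulye ?lte_fin // leey.
rewrite -(fineK Dfin) -EFinM; apply: esum_mul_le.
- by move=> C; rewrite mulr_ge0.
- by move=> C; rewrite mulr_ge0.
- by rewrite mulr_ge0 ?fine_ge0 // ltW.
move=> X Y uX uY XS YS.
have [N1 H1] := cells_cover XS; have [N2 H2] := cells_cover YS.
have {H1} XN := H1 _ (leq_maxl N1 N2); have {H2} YN := H2 _ (leq_maxr N1 N2).
set N := maxn N1 N2 in XN YN.
(* Both finite families are enlarged to the same list [cells k N c], as Harris' inequality requires
   a common index set. *)
apply: le_trans (ler_pM _ _ (ler_sum_subset uX XN _) (ler_sum_subset uY YN _)) _.
- by apply: sumr_ge0 => C _; rewrite mulr_ge0.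
- by apply: sumr_ge0 => C _; rewrite mulr_ge0.
- by move=> C; rewrite mulr_ge0.
- by move=> C; rewrite mulr_ge0.
under eq_bigr do rewrite fhE; under [X in (_ * X <= _)%R]eq_bigr do rewrite fvE.
apply: le_trans (harris_cells hz0 hz1 k N c fh_homo fv_homo _ _) _ => [w|w|];
  rewrite ?ler0n //.
(* After cancelling [Q z ^+ c], what remains on the left is a finite partial sum of [D]. *)
rewrite mulrC ler_pM2r // -lee_fin fineK //.
apply: le_trans (sum_le_esum _ (cells_uniq k N c) (@cells_connecting k N c)).
by rewrite lee_fin; under [leRHS]eq_bigr do rewrite fhE fvE -mulrA.
Qed.
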